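(* Let $E$ and $F$ be small graphs whose adjacency matrices $A_E$ and $A_F$ are shift equivalent. Then $A_E$ and $A_F$ are elementary shift equivalent, except in the one case where $\{E,F\}=\{E^2_3,E^2_4\}$ (up to graph isomorphism). The adjacency matrices of $E^2_3$ and $E^2_4$ are shift equivalent but not elementary shift equivalent.
   Context: Graphs are directed; the adjacency matrix $A_E$ has $(v,w)$ entry the number of edges from $v$ to $w$. Square nonnegative integer matrices $A,B$ (possibly of different sizes) are elementary shift equivalent if there are nonnegative integer matrices $R,S$ (not necessarily square) with $A=RS$ and $B=SR$. $A,B$ are shift equivalent if there are $k\ge 1$ and nonnegative integer matrices $R,S$ with $A^k=RS$, $B^k=SR$, $AR=RB$, $SA=BS$. Small graphs. A small graph is a connected directed graph with exactly three vertices, no parallel edges, no sinks, whose only hereditary and saturated vertex subsets are $\emptyset$ and the whole vertex set, and in which every cycle has an exit (equivalently here, the Leavitt path algebra is purely infinite simple). Up to isomorphism these are exactly 34 graphs, with the following adjacency matrices (rows separated by semicolons): $E^1_1$: [0 1 0; 0 0 1; 1 0 1]. $E^1_2$: [1 1 0; 0 0 1; 1 0 1]. $E^1_3$: [1 1 0; 0 1 1; 1 0 1]. $E^1_4$: [0 1 0; 0 0 1; 1 1 0]. $E^1_5$: [1 1 0; 0 0 1; 1 1 0]. $E^1_6$: [1 1 0; 0 0 1; 1 1 1]. $E^1_7$: [1 1 0; 0 1 1; 1 1 0]. $E^1_8$: [1 1 0; 1 0 1; 1 1 1]. $E^1_9$: [1 1 0; 1 1 1; 1 1 1]. $E^1_{10}$: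 [0 1 1; 1 0 0; 1 0 0]. $E^1_{11}$: [0 1 1; 1 0 0; 1 0 1]. $E^1_{12}$: [1 1 1; 1 0 0; 1 0 1]. $E^1_{13}$: [0 0 1; 1 0 0; 1 0 1]. $E^1_{14}$: [1 0 1; 1 0 0; 1 0 0]. $E^1_{15}$: [1 0 1; 1 0 0; 1 0 1]. $E^1_{16}$: [0 1 1; 0 0 1; 0 1 1]. $E^1_{17}$: [0 1 1; 0 1 1; 0 1 1]. $E^1_{18}$: [1 1 0; 0 1 1; 1 1 1]. $E^2_1$: [0 1 0; 0 1 1; 1 1 1]. $E^2_2$: [0 1 0; 1 0 1; 1 1 0]. $E^2_3$: [0 1 0; 1 0 1; 1 1 1]. $E^2_4$: [1 1 0; 1 0 1; 1 1 0]. $E^2_5$: [0 1 0; 0 1 1; 1 1 0]. $E^2_6$: [1 1 0; 1 1 1; 1 1 0]. $E^3_1$: [0 1 0; 0 0 1; 1 1 1]. $E^3_2$: [0 1 0; 1 1 1; 1 1 1]. $E^3_3$: [1 1 1; 1 1 1; 1 1 1]. $E^3_4$: [1 1 1; 1 0 0; 1 0 0]. $E^4_1$: [0 1 0; 1 1 1; 1 1 0]. $E^4_2$: [1 1 1; 1 1 1; 1 1 0]. $E^5_1$: [1 1 1; 1 0 1; 1 1 0]. $E^6_1$: [0 1 1; 1 0 1; 1 1 0]. $E^7_1$: [0 1 1; 1 1 0; 1 0 1]. $E^7_2$: [1 1 1; 1 1 0; 1 0 1]. *)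

(* Defs.v *)
From HB Require Import structures.
From mathcomp Require Import all_boot all_order all_algebra.
Set Implicit Arguments.
Unset Strict Implicit.
Unset Printing Implicit Defensive.
Import GRing.Theory.
Local Open Scope ring_scope.

(** Finite directed graphs, loops and parallel edges allowed. *)
Record digraph := Digraph {
  vertex : finType;
  edge : finType;
  src : edge -> vertex;
  tgt : edge -> vertex
}.

(** The vertices are numbered by [enum_val]. *)
Definition adjmx (G : digraph) : 'M[nat]_#|vertex G| :=
  \matrix_(i, j)
    #|[set e : edge G | (src e == enum_val i) && (tgt e == enum_val j)]|.

Definition digraph_iso (G H : digraph) : Prop :=
  exists (f : vertex G -> vertex H) (g : edge G -> edge H),
    [/\ bijective f, bijective g,
        forall e, src (g e) = f (src e)
      & forall e, tgt (g e) = f (tgt e)].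

Definition elementary_shift_equiv (m n : nat)
    (A : 'M[nat]_m) (B : 'M[nat]_n) : Prop :=
  exists (R : 'M[nat]_(m, n)) (S : 'M[nat]_(n, m)),
    A = R *m S /\ B = S *m R.

Definition shift_equiv (m n : nat) (A : 'M[nat]_m) (B : 'M[nat]_n) : Prop :=
  exists (k : nat) (R : 'M[nat]_(m, n)) (S : 'M[nat]_(n, m)),
    (1 <= k)%N /\
    [/\ A ^+ k = R *m S, B ^+ k = S *m R, A *m R = R *m B & S *m A = B *m S].

Section GraphNotions.
Variable G : digraph.

Definition adjacent : rel (vertex G) :=
  [rel v w | [exists e : edge G, (src e == v) && (tgt e == w)]].

(** Connectedness of the underlying undirected graph. *)
Definition connected : Prop :=
  forall v w : vertex G, connect [rel x y | adjacent x y || adjacent y x] v w.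

Definition no_parallel_edges : Prop :=
  forall e f : edge G, src e = src f -> tgt e = tgt f -> e = f.

Definition sink (v : vertex G) : Prop := forall e : edge G, src e <> v.

Definition hereditary (H : {set vertex G}) : Prop :=
  forall e : edge G, src e \in H -> tgt e \in H.

Definition saturated (H : {set vertex G}) : Prop :=
  forall v : vertex G, ~ sink v ->
    (forall e : edge G, src e = v -> tgt e \in H) -> v \in H.

(** Closed paths of positive length that visit each vertex at most once. *)
Definition graph_cycle (c : seq (edge G)) : Prop :=
  [/\ c != [::], cycle [rel e f | tgt e == src f] c
    & uniq [seq src e | e <- c]].

Definition has_exit (c : seq (edge G)) : Prop :=
  exists e f : edge G, [/\ e \in c, src f = src e & f <> e].

End GraphNotions.

Record small_graph (G : digraph) : Prop := SmallGraph {
  small_card : #|vertex G| = 3%N;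
  small_connected : connected G;
  small_simple : no_parallel_edges G;
  small_no_sink : forall v : vertex G, ~ sink v;
  small_hersat : forall H : {set vertex G},
    hereditary H -> saturated H -> H = set0 \/ H = setT;
  small_exit : forall c : seq (edge G), graph_cycle c -> has_exit c
}.

(** The graph with vertex set ['I_n] and [A i j] edges from [i] to [j]. *)
Definition digraph_of_mx (n : nat) (A : 'M[nat]_n) : digraph :=
  @Digraph 'I_n {p : 'I_n * 'I_n & 'I_(A p.1 p.2)}
    (fun e => (tag e).1) (fun e => (tag e).2).

Definition mx3_of_rows (rows : seq (seq nat)) : 'M[nat]_3 :=
  \matrix_(i < 3, j < 3) nth 0%N (nth [::] rows i) j.

Definition E2_3 : digraph :=
  digraph_of_mx (mx3_of_rows [:: [:: 0; 1; 0]; [:: 1; 0; 1]; [:: 1; 1; 1]]%N).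

Definition E2_4 : digraph :=
  digraph_of_mx (mx3_of_rows [:: [:: 1; 1; 0]; [:: 1; 0; 1]; [:: 1; 1; 0]]%N).

(* Main.v *)
Require Import Defs.
From mathcomp Require Import all_boot all_order all_algebra.

(** Traces of powers are invariants of shift equivalence: tr A^n = tr B^n for
    all large n because A^(l+k) = A^l R S and B^(l+k) = S A^l R, and tr A^p = tr A
    modulo a prime p, so taking p large recovers tr A = tr B.  Up to
    isomorphism few 0/1 matrices of size 3 have no zero row and only trivial
    hereditary saturated sets; among them, the traces of the first three powers
    already force elementary shift equivalence by 0/1 matrices R, S, except for
    the pair E^2_3, E^2_4.  For that pair any nonnegative R, S with A = RS,
    B = SR would have entries 0 and 1, and there are none. *)

Set Implicit Arguments.
Unset Strict Implicit.
Unset Printing Implicit Defensive.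
Import GRing.Theory.
Local Open Scope ring_scope.

(** * Traces of powers are invariants of shift equivalence *)

(** In characteristic [p] the [p]-th power map is a ring morphism, so induction on the polynomial
    reduces the identity to constants and ['X]. *)
Lemma poly_Frobenius (R : comNzRingType) (p : nat) (pR : p \in [pchar R])
    (q : {poly R}) :
  q ^+ p = map_poly (pFrobenius_aut pR) q \Po 'X^p.
Proof.
have pP : p \in [pchar {poly R}] by rewrite pchar_poly.
elim/poly_ind: q => [|q c IHq].
  by rewrite map_poly0 comp_poly0 expr0n gtn_eqF // prime_gt0 ?(pcharf_prime pR).
rewrite -(pFrobenius_autE pP) !rmorphD !rmorphM /= map_polyC comp_polyC.
by rewrite map_polyX comp_polyX !pFrobenius_autE IHq -polyC_exp.
Qed.

(* Take determinants in [('X - A) ^+ p = 'X^p - A ^+ p] over the polynomial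
   ring: the characteristic polynomial of [A ^+ p] is that of [A] with its
   coefficients raised to the power [p]. *)
Lemma mxtrace_Frobenius (R : comNzRingType) (p : nat) (n : nat) (A : 'M[R]_n) :
  p \in [pchar R] -> \tr (A ^+ p) = (\tr A) ^+ p.
Proof.
move=> pR; have p_gt0 := prime_gt0 (pcharf_prime pR).
case: n A => [|n] A.
  by rewrite /mxtrace !big_ord0 expr0n gtn_eqF.
have pP : p \in [pchar {poly R}] by rewrite pchar_poly.
have pM : p \in [pchar 'M[{poly R}]_n.+1].
  rewrite inE (pcharf_prime pR) /=; apply/eqP.
  by rewrite -[LHS](rmorph_nat (@scalar_mx {poly R} n.+1)) (pcharf0 pP) rmorph0.
have charAp : map_poly (pFrobenius_aut pR) (char_poly A) \Po 'X^p
              = char_poly (A ^+ p) \Po 'X^p.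
  rewrite -poly_Frobenius /char_poly -det_map_mx.
  have detX k (B : 'M[{poly R}]_n.+1) : \det B ^+ k = \det (B ^+ k).
    by elim: k => [|k IHk]; rewrite ?expr0 ?det1 // !exprS detM IHk.
  rewrite detX; congr (\det _).
  rewrite -(pFrobenius_autE pM) pFrobenius_autB_comm; last exact: comm_scalar_mx.
  rewrite !pFrobenius_autE -!rmorphXn /=; apply/matrixP => i j.
  by rewrite !mxE raddfB /= comp_polyC raddfMn /= comp_polyX.
(* For a matrix of size [n.+1] the coefficient of degree [n] of the characteristic polynomial is
   minus the trace; composition with ['X^p] moves it to degree [n * p]. *)
move/(congr1 (fun q : {poly R} => q`_(n * p))): charAp.
rewrite !coef_comp_poly_Xn // dvdn_mull // mulnK // coef_map.
rewrite !char_poly_trace //= pFrobenius_autN.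
by move/oppr_inj => <-.
Qed.

(** Over ['F_p] the trace commutes with the [p]-th power, and Fermat's little theorem removes that
    power from the trace. *)
Lemma mxtrace_exp_prime (p : nat) (n : nat) (A : 'M[nat]_n) :
  prime p -> \tr (A ^+ p) = \tr A %[mod p].
Proof.
move=> p_pr; have pF := pchar_Fp p_pr.
have natr_mod (a b : nat) : a%:R = b%:R :> 'F_p -> a = b %[mod p].
  by move/(congr1 val); rewrite /= !val_Fp_nat.
rewrite -(fermat_little (\tr A) p_pr); apply: natr_mod.
pose f : {rmorphism nat -> 'F_p} := GRing.natmul 1.
have mapX k : map_mx f (A ^+ k) = map_mx f A ^+ k.
  by elim: k => [|k IHk]; rewrite ?expr0 ?map_mx1 // !exprS map_mxM IHk.
by rewrite natrX -[LHS]/(f _) -[_%:R]/(f _) -!trace_map_mx mapX mxtrace_Frobenius.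
Qed.

Lemma shift_equiv_mxtrace (m n : nat) (A : 'M[nat]_m) (B : 'M[nat]_n) (j : nat) :
  shift_equiv A B -> (0 < j)%N -> \tr (A ^+ j) = \tr (B ^+ j).
Proof.
move=> [k [R [S [_ [ARS BSR AR SA]]]]] j_gt0.
have tr_ge (l : nat) : \tr (A ^+ (l + k)) = \tr (B ^+ (l + k)).
  rewrite !exprD ARS BSR -[LHS]/(\tr (_ *m _)) -[RHS]/(\tr (_ *m _)).
  rewrite mulmxA mxtrace_mulC [RHS]mxtrace_mulC.
  suff AlR : A ^+ l *m R = R *m B ^+ l by rewrite AlR mulmxA.
  elim: l => [|l IHl]; first by rewrite !expr0 mul1mx mulmx1.
  have -> : A ^+ l.+1 = A *m A ^+ l by exact: exprS.
  have -> : B ^+ l.+1 = B *m B ^+ l by exact: exprS.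
  by rewrite -mulmxA IHl !mulmxA AR.
(* A prime above both traces lets residues modulo [p] determine them; being above [k] it also makes
   [j * p] at least the lag. *)
have [p p_gt p_pr] := prime_above (\tr (A ^+ j) + \tr (B ^+ j) + k)%N.
have p_le: (k <= j * p)%N.
  by rewrite (leq_trans _ (leq_pmull _ j_gt0)) // (leq_trans _ (ltnW p_gt)) ?leq_addl.
have := tr_ge (j * p - k)%N; rewrite subnK // !exprM => /(congr1 (modn^~ p)).
rewrite !mxtrace_exp_prime // !modn_small //; apply: leq_ltn_trans p_gt.
  by rewrite -addnA addnCA leq_addr.
by rewrite -addnA leq_addr.
Qed.

(** * Renumbering the index set of a matrix *)

Lemma mulmx_mxsub (m n p m' n' p' : nat) (f : 'I_m' -> 'I_m)
    (g : 'I_n' -> 'I_n) (h : 'I_p' -> 'I_p)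
    (A : 'M[nat]_(m, n)) (B : 'M[nat]_(n, p)) :
  bijective g -> mxsub f g A *m mxsub g h B = mxsub f h (A *m B).
Proof.
move=> g_bij; apply/matrixP => i j; rewrite !mxE.
rewrite [RHS](reindex g); last exact: onW_bij.
by apply: eq_bigr => k _; rewrite !mxE.
Qed.

Lemma mxsub_exp (m n : nat) (f : 'I_m -> 'I_n) (A : 'M[nat]_n) (k : nat) :
  bijective f -> mxsub f f A ^+ k = mxsub f f (A ^+ k).
Proof.
move=> f_bij; elim: k => [|k IHk].
  by apply/matrixP => i j; rewrite !expr0 !mxE (inj_eq (bij_inj f_bij)).
have -> : mxsub f f A ^+ k.+1 = mxsub f f A *m mxsub f f A ^+ k by exact: exprS.
by rewrite IHk mulmx_mxsub // exprS.
Qed.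

Lemma mxtrace_mxsub (m n : nat) (f : 'I_m -> 'I_n) (A : 'M[nat]_n) :
  bijective f -> \tr (mxsub f f A) = \tr A.
Proof.
move=> f_bij; rewrite [RHS](reindex f); last exact: onW_bij.
by apply: eq_bigr => i _; rewrite mxE.
Qed.

Lemma mxsub_bij_inv (m n : nat) (f : 'I_m -> 'I_n) (A : 'M[nat]_n) :
  bijective f ->
  exists2 f' : 'I_n -> 'I_m, bijective f' & A = mxsub f' f' (mxsub f f A).
Proof.
case=> f' fK f'K; exists f'; first by exists f.
by apply/matrixP => i j; rewrite !mxE !f'K.
Qed.

Lemma elementary_shift_equiv_mxsub (m n m' n' : nat) (f : 'I_m' -> 'I_m)
    (g : 'I_n' -> 'I_n) (A : 'M[nat]_m) (B : 'M[nat]_n) :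
  bijective f -> bijective g ->
  elementary_shift_equiv A B ->
  elementary_shift_equiv (mxsub f f A) (mxsub g g B).
Proof.
move=> f_bij g_bij [R [S [-> ->]]].
by exists (mxsub f g R), (mxsub g f S); rewrite !mulmx_mxsub.
Qed.

Lemma shift_equiv_mxsub (m n m' n' : nat) (f : 'I_m' -> 'I_m)
    (g : 'I_n' -> 'I_n) (A : 'M[nat]_m) (B : 'M[nat]_n) :
  bijective f -> bijective g ->
  shift_equiv A B -> shift_equiv (mxsub f f A) (mxsub g g B).
Proof.
move=> f_bij g_bij [k [R [S [k_gt0 [ARS BSR AR SA]]]]].
exists k, (mxsub f g R), (mxsub g f S).
by rewrite !mxsub_exp // !mulmx_mxsub // ARS BSR AR SA.
Qed.

(** * Elementary shift equivalence of 0/1 matrices *)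

Lemma elementary_shift_equiv_refl (n : nat) (A : 'M[nat]_n) :
  elementary_shift_equiv A A.
Proof. by exists A, 1%:M; rewrite mulmx1 mul1mx. Qed.

(** Each product [R i j * S j l] is a summand of [A i l], hence at most 1. Nonzero rows of [B] force
    nonzero rows of [S], and nonzero columns of [B] force nonzero columns of [R], so every entry of
    one factor meets a positive entry of the other. *)
Lemma elementary_shift_equiv_le1 (m n : nat) (A : 'M[nat]_m) (B : 'M[nat]_n)
    (R : 'M[nat]_(m, n)) (S : 'M[nat]_(n, m)) :
  A = R *m S -> B = S *m R ->
  (forall i j, (A i j <= 1)%N) ->
  (forall i, exists j, B i j != 0%N) -> (forall j, exists i, B i j != 0%N) ->
  (forall i j, (R i j <= 1)%N) /\ (forall i j, (S i j <= 1)%N).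
Proof.
move=> AE BE A_le1 Brow Bcol.
have RS_le1 i j l : (R i j * S j l <= 1)%N.
  by apply: leq_trans (A_le1 i l); rewrite AE mxE (bigD1 j) //= leq_addr.
have S_row j : exists l, (0 < S j l)%N.
  have [l] := Brow j; rewrite BE mxE sum_nat_eq0 negb_forall => /existsP[i].
  by rewrite /= muln_eq0 negb_or -lt0n => /andP[Sji _]; exists i.
have R_col j : exists i, (0 < R i j)%N.
  have [l] := Bcol j; rewrite BE mxE sum_nat_eq0 negb_forall => /existsP[i].
  by rewrite /= muln_eq0 negb_or -!lt0n => /andP[_ Rij]; exists i.
split=> i j.
  by have [l Sjl] := S_row j; apply: leq_trans (RS_le1 i j l); rewrite leq_pmulr.
by have [l Rli] := R_col i; apply: leq_trans (RS_le1 l i j); rewrite leq_pmull.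
Qed.

(** * Matrices given by lists of rows *)

Section Choices.
Variable T : eqType.

Definition choices (ss : seq (seq T)) : seq (seq T) :=
  foldr (fun s ws => [seq x :: w | x <- s, w <- ws]) [:: [::]] ss.

Lemma mem_choices (ss : seq (seq T)) (w : seq T) :
  (w \in choices ss) = all2 (fun x s => x \in s) w ss.
Proof.
elim: ss w => [|s ss IHss] [|x w] //=.
  by apply/allpairsP => -[[y v] [_ _]].
apply/allpairsP/andP => [[[y v] [/= ys vss [-> ->]]]|[xs wss]].
  by rewrite -IHss.
by exists (x, w); rewrite /= IHss.
Qed.

(** A condition that splits over the letters can be tested on each factor before the Cartesian
    product is formed; this prunes the search for [R]. *)
Lemma mem_choices_filter (U : Type) (p : T -> U -> bool) (vs : seq T)
    (rs : seq U) (w : seq T) :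
  (w \in choices [seq [seq v <- vs | p v r] | r <- rs])
  = (w \in choices (nseq (size rs) vs)) && all2 p w rs.
Proof.
rewrite !mem_choices; elim: rs w => [|r rs IHrs] [|x w] //=.
by rewrite IHrs mem_filter -!andbA; do !bool_congr.
Qed.

End Choices.

(** Lists of rows reduce by evaluation, as the finite search requires; missing entries read as 0. *)
Definition entry (a : seq (seq nat)) (i j : nat) : nat :=
  nth 0%N (nth [::] a i) j.

Definition row_mul (v : seq nat) (S : seq (seq nat)) : seq nat :=
  mkseq (fun j => sumn (mkseq (fun k => nth 0 v k * entry S k j) 3)) 3.

Definition rows_mul (R S : seq (seq nat)) : seq (seq nat) :=
  mkseq (fun i => row_mul (nth [::] R i) S) 3.

Definition rows_tr (a : seq (seq nat)) : nat :=
  sumn (mkseq (fun i => entry a i i) 3).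

(** By Newton's identities these three numbers determine the characteristic polynomial of a matrix
    of size 3. *)
Definition traces (a : seq (seq nat)) : seq nat :=
  let a2 := rows_mul a a in
  [:: rows_tr a; rows_tr a2; rows_tr (rows_mul a a2)].

Definition renumber (a : seq (seq nat)) (s : seq nat) : seq (seq nat) :=
  mkseq (fun i => mkseq (fun j => entry a (nth 0 s i) (nth 0 s j)) 3) 3.

Definition rows_of (A : 'M[nat]_3) : seq (seq nat) :=
  mkseq (fun i => mkseq (fun j => A (inord i) (inord j)) 3) 3.

Lemma mx3_of_rowsM (R S : seq (seq nat)) :
  mx3_of_rows (rows_mul R S) = mx3_of_rows R *m mx3_of_rows S.
Proof.
apply/matrixP => i j; rewrite !mxE !nth_mkseq //.
by rewrite !big_ord_recl big_ord0 !mxE.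
Qed.

Lemma mxtrace_mx3_of_rows (a : seq (seq nat)) :
  \tr (mx3_of_rows a) = rows_tr a.
Proof. by rewrite /mxtrace !big_ord_recl big_ord0 !mxE. Qed.

Lemma traces_mx3_of_rows (a : seq (seq nat)) :
  traces a = [seq \tr (mx3_of_rows a ^+ k) | k <- [:: 1; 2; 3]%N].
Proof.
rewrite /traces /= -!mxtrace_mx3_of_rows !mx3_of_rowsM.
by rewrite expr1 (expr2 (mx3_of_rows a)) !exprS expr0 mulr1.
Qed.

Lemma rows_ofK (A : 'M[nat]_3) : mx3_of_rows (rows_of A) = A.
Proof. by apply/matrixP => i j; rewrite mxE !nth_mkseq // !inord_val. Qed.

Lemma entry_rows_of (A : 'M[nat]_3) (i j : 'I_3) : entry (rows_of A) i j = A i j.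
Proof. by rewrite /entry !nth_mkseq // !inord_val. Qed.

Lemma rows_of_mulmx (A B : 'M[nat]_3) :
  rows_of (A *m B) = rows_mul (rows_of A) (rows_of B).
Proof.
rewrite -{1}(rows_ofK A) -{1}(rows_ofK B) -mx3_of_rowsM {1}/rows_of /mkseq /=.
by rewrite !mxE !inordK.
Qed.

Definition bits3 : seq (seq nat) := choices (nseq 3 [:: 0; 1]%N).

Definition binary_rows : seq (seq (seq nat)) := choices (nseq 3 bits3).

Lemma mem_binary_rows (A : 'M[nat]_3) :
  (forall i j, (A i j <= 1)%N) -> rows_of A \in binary_rows.
Proof.
move=> A_le1; have bit i j : A (inord i) (inord j) \in [:: 0; 1]%N.
  by have := A_le1 (inord i) (inord j); case: (A _ _) => [|[]].
have row i : mkseq (fun j => A (inord i) (inord j)) 3 \in bits3.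
  by rewrite mem_choices /= !bit.
by rewrite mem_choices /= !row.
Qed.

Definition perms3 : seq (seq nat) := permutations (iota 0 3).

Lemma mx3_of_renumber (a : seq (seq nat)) (s : seq nat) :
  s \in perms3 ->
  exists2 f : 'I_3 -> 'I_3,
    bijective f & mx3_of_rows (renumber a s) = mxsub f f (mx3_of_rows a).
Proof.
rewrite mem_permutations => s_perm.
have s_size : size s = 3%N by rewrite (perm_size s_perm).
have s_uniq : uniq s by rewrite (perm_uniq s_perm) iota_uniq.
have s_lt (i : 'I_3) : (nth 0 s i < 3)%N.
  have: nth 0%N s i \in iota 0 3 by rewrite -(perm_mem s_perm) mem_nth ?s_size.
  by rewrite mem_iota.
exists (fun i => Ordinal (s_lt i)).
  apply: injF_bij => i j /(congr1 val) /= /eqP.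
  by rewrite nth_uniq ?s_size // => /eqP/val_inj.
by apply/matrixP => i j; rewrite !mxE !nth_mkseq.
Qed.

(** * The finite search *)

(* Entries 0 and 1 suffice for [R] and [S] when [b] has neither zero rows nor
   zero columns, see [elementary_shift_equiv_le1]. *)
Definition binary_ese (a b : seq (seq nat)) : bool :=
  has (fun S =>
    has (fun R => rows_mul S R == b)
      (choices [seq [seq v <- bits3 | row_mul v S == r]
               | r <- a]))
    binary_rows.

(** Row [i] of [R S] depends only on row [i] of [R], so for fixed [S] filtering the candidates row
    by row leaves exactly the 0/1 matrices [R] with [R S = a]. *)
Lemma binary_eseP (a b : seq (seq nat)) :
  size a = 3%N ->
  reflect (exists R S, [/\ R \in binary_rows, S \in binary_rows,
                          rows_mul R S = a & rows_mul S R = b])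
    (binary_ese a b).
Proof.
have all2E (R S c : seq (seq nat)) : size c = 3%N -> R \in binary_rows ->
    all2 (fun v r => row_mul v S == r) R c = (rows_mul R S == c).
  case: c => [|r0 [|r1 [|r2 [|? ?]]]] // _; rewrite mem_choices.
  by case: R => [|v0 [|v1 [|v2 [|? ?]]]]; rewrite /= ?andbF.
move=> a3; apply: (iffP hasP) => [[S S_bin /hasP[R]]|].
  rewrite mem_choices_filter a3 => /andP[R_bin]; rewrite all2E // => /eqP RS.
  by move/eqP=> SR; exists R, S.
case=> R [S [R_bin S_bin RS SR]].
exists S => //; apply/hasP; exists R; last exact/eqP.
by rewrite mem_choices_filter a3 all2E // RS eqxx andbT.
Qed.

Lemma binary_ese_equiv (a b : seq (seq nat)) :
  size a = 3%N -> binary_ese a b ->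
  elementary_shift_equiv (mx3_of_rows a) (mx3_of_rows b).
Proof.
move=> a3 /(binary_eseP _ a3)[R [S [_ _ <- <-]]].
by exists (mx3_of_rows R), (mx3_of_rows S); rewrite !mx3_of_rowsM.
Qed.

(** * Candidate adjacency matrices up to renumbering *)

Definition no_zero_row (a : seq (seq nat)) : bool :=
  all (fun i => has (fun j => entry a i j != 0%N) (iota 0 3)) (iota 0 3).

(** A vertex subset is coded by its list of three membership bits. *)
Definition hereditary_mask (a : seq (seq nat)) (m : seq bool) : bool :=
  all (fun i => all (fun j => nth false m i && (entry a i j != 0%N)
                              ==> nth false m j) (iota 0 3)) (iota 0 3).

(** This agrees with saturation in the presence of [no_zero_row], when no vertex is a sink. *)
Definition saturated_mask (a : seq (seq nat)) (m : seq bool) : bool :=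
  all (fun i => all (fun j => (entry a i j != 0%N) ==> nth false m j) (iota 0 3)
                ==> nth false m i) (iota 0 3).

Definition masks : seq (seq bool) := choices (nseq 3 [:: true; false]).

Definition admissible (a : seq (seq nat)) : bool :=
  no_zero_row a &&
  all (fun m => hereditary_mask a m && saturated_mask a m ==>
                (m \in [:: nseq 3 true; nseq 3 false])) masks.

(** A matrix is dropped when a renumbering of it survives from the rest of the list, so the search
    compares isomorphism classes instead of all numberings. *)
Fixpoint transversal (l : seq (seq (seq nat))) : seq (seq (seq nat)) :=
  if l is a :: l' then
    let t := transversal l' in
    if has (fun s => renumber a s \in t) perms3 then t else a :: t
  else [::].

Lemma mem_transversal (l : seq (seq (seq nat))) (a : seq (seq nat)) :
  a \in l ->
  a \in transversal l \/ exists2 s, s \in perms3 & renumber a s \in transversal l.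
Proof.
elim: l => // c l IHl; rewrite inE /transversal -/transversal.
case: ifP => [/hasP[s s_perm cs]|_] /predU1P[->|/IHl[al|[t t_perm al]]].
- by right; exists s.
- by left.
- by right; exists t.
- by left; rewrite mem_head.
- by left; rewrite inE al orbT.
by right; exists t; rewrite // inE al orbT.
Qed.

Lemma transversal_sub (l : seq (seq (seq nat))) : {subset transversal l <= l}.
Proof.
elim: l => // c l IHl a; rewrite /transversal -/transversal.
case: ifP => _; [move=> al|case/predU1P=> [->|al]]; rewrite inE ?eqxx //.
  by rewrite IHl ?orbT.
by rewrite IHl ?orbT.
Qed.

Definition small_reps := transversal [seq a <- binary_rows | admissible a].

Lemma size_small_reps (a : seq (seq nat)) : a \in small_reps -> size a = 3%N.
Proof.
move/transversal_sub; rewrite mem_filter => /andP[_].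
by rewrite mem_choices; case: a => [|? [|? [|? [|? ?]]]] //=; rewrite !andbF.
Qed.

Definition rows23 := [:: [:: 0; 1; 0]; [:: 1; 0; 1]; [:: 1; 1; 1]]%N.
Definition rows24 := [:: [:: 1; 1; 0]; [:: 1; 0; 1]; [:: 1; 1; 0]]%N.

Definition renumbers (a b : seq (seq nat)) : bool :=
  has (fun s => renumber a s == b) perms3.

(* Call-by-value evaluation would run the search on all pairs of
   representatives, also on those with different traces. *)
Lemma small_reps_equal_traces :
  let ts := [seq (traces a, a) | a <- small_reps] in
  all (fun x => all (fun y => (x.1 == y.1) ==>
    [|| x.2 == y.2, binary_ese x.2 y.2,
        renumbers x.2 rows23 && renumbers y.2 rows24 |
        renumbers x.2 rows24 && renumbers y.2 rows23]) ts) ts.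
Proof. by lazy. Qed.

Lemma small_repsP (a b : seq (seq nat)) :
  a \in small_reps -> b \in small_reps -> traces a = traces b ->
  [\/ a = b, binary_ese a b,
      renumbers a rows23 && renumbers b rows24 |
      renumbers a rows24 && renumbers b rows23].
Proof.
move=> a_rep b_rep ab.
have /allP/(_ _ (map_f (fun c => (traces c, c)) a_rep)) := small_reps_equal_traces.
move/allP/(_ _ (map_f (fun c => (traces c, c)) b_rep)) => /=.
rewrite ab eqxx /= => /or4P[/eqP|||] H.
- exact: Or41.
- exact: Or42.
- exact: Or43.
exact: Or44.
Qed.

Lemma rows23_24_not_elementary :
  ~ elementary_shift_equiv (mx3_of_rows rows23) (mx3_of_rows rows24).
Proof.
case=> R [S [RS SR]].
(* [rows23] has entries 0 and 1, and [rows24] has no zero row or column; hence the search over 0/1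
   factors is exhaustive. *)
have [|||R_le1 S_le1] := elementary_shift_equiv_le1 RS SR.
- by move=> [[|[|[|//]]] ?] [[|[|[|//]]] ?]; rewrite mxE.
- by case=> [[|[|[|//]]] ?]; exists ord0; rewrite mxE.
- by case=> [[|[|[|//]]] ?]; [exists ord0|exists ord0|exists (inord 1)];
    rewrite mxE ?inordK.
have /negP[] : ~~ binary_ese rows23 rows24 by lazy.
apply/binary_eseP => //; exists (rows_of R), (rows_of S).
rewrite -!rows_of_mulmx -RS -SR /rows_of /mkseq /= !mxE !inordK //.
by split=> //; exact: mem_binary_rows.
Qed.

(** * From graphs to matrices *)

(** [adjmx G] is indexed by ['I_#|vertex G|], a type that need not be convertible to ['I_3]; an
    arbitrary bijection bridges the two and absorbs renumberings. *)
Definition numbered (G : digraph) (M : 'M[nat]_3) : Prop :=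
  exists2 f : 'I_#|vertex G| -> 'I_3,
    bijective f & adjmx G = mxsub f f M.

Lemma numbered_renumber (G : digraph) (a : seq (seq nat)) (s : seq nat) :
  s \in perms3 -> numbered G (mx3_of_rows a) ->
  numbered G (mx3_of_rows (renumber a s)).
Proof.
move=> /(mx3_of_renumber a)[g g_bij ->] [f f_bij GM].
have [g' g'_bij aE] := mxsub_bij_inv (mx3_of_rows a) g_bij.
exists (g' \o f); first exact: bij_comp.
by rewrite GM mxsub_comp -aE.
Qed.

Lemma adjmx_gt0P (G : digraph) (v w : vertex G) :
  reflect (exists e : edge G, src e = v /\ tgt e = w)
    (0 < adjmx G (enum_rank v) (enum_rank w))%N.
Proof.
rewrite mxE !enum_rankK; apply: (iffP card_gt0P) => -[e].
  by rewrite inE => /andP[/eqP<- /eqP<-]; exists e.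
by case=> <- <-; exists e; rewrite inE !eqxx.
Qed.

Lemma adjmx_le1 (G : digraph) (i j : 'I_#|vertex G|) :
  no_parallel_edges G -> (adjmx G i j <= 1)%N.
Proof.
move=> simpleG; rewrite mxE; apply/card_le1_eqP => e f; rewrite !inE.
move=> /andP[/eqP e_src /eqP e_tgt] /andP[/eqP f_src /eqP f_tgt].
by apply: simpleG; rewrite ?e_src ?e_tgt.
Qed.

(** Without parallel edges an edge is determined by its end points and the entries of [M] are at
    most 1, so each edge goes to the only edge, numbered 0, between the matching positions. *)
Lemma numbered_iso (G : digraph) (M : 'M[nat]_3) :
  no_parallel_edges G -> numbered G M -> digraph_iso G (digraph_of_mx M).
Proof.
move=> simpleG [f f_bij GM]; have [f' fK f'K] := f_bij.
pose pos v := f (enum_rank v).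
have pos_inj : injective pos by move=> v w /(bij_inj f_bij)/enum_rank_inj.
have posK i : pos (enum_val (f' i)) = i by rewrite /pos enum_valK f'K.
have M_pos v w : M (pos v) (pos w) = adjmx G (enum_rank v) (enum_rank w).
  by rewrite GM mxE.
have edge_pos e : (0 < M (pos (src e)) (pos (tgt e)))%N.
  by rewrite M_pos; apply/adjmx_gt0P; exists e.
pose g e : edge (digraph_of_mx M) :=
  existT (fun p : 'I_3 * 'I_3 => 'I_(M p.1 p.2)) (pos (src e), pos (tgt e))
    (Ordinal (edge_pos e)).
exists pos, g; split=> //.
  by exists (fun i => enum_val (f' i)) => // v; rewrite /pos fK enum_rankK.
have g_inj : injective g.
  move=> e e' /(congr1 tag) [/pos_inj e_src /pos_inj e_tgt].
  exact: simpleG.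
apply: inj_card_bij => //; rewrite -(card_codom g_inj); apply/subset_leq_card.
apply/subsetP => -[[i j] k] _; apply/codomP.
move: k; rewrite -(posK i) -(posK j).
set v := enum_val (f' i); set w := enum_val (f' j) => k.
have /adjmx_gt0P[e [ve we]] : (0 < adjmx G (enum_rank v) (enum_rank w))%N.
  by rewrite -M_pos; apply: leq_trans (ltn_ord k).
exists e; rewrite /g; move: (edge_pos e); rewrite ve we => M_gt0.
congr existT; apply: val_inj => /=.
have M_le1 : (M (pos v) (pos w) <= 1)%N by rewrite M_pos adjmx_le1.
by case: k => -[|k] ltk //=; have := leq_trans ltk M_le1.
Qed.

(** The edges between two given vertices are the image of the fibre [T p], an ordinal type of the
    right size, under the injective tagging map. *)
Lemma numbered_digraph_of_mx (M : 'M[nat]_3) : numbered (digraph_of_mx M) M.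
Proof.
exists enum_val; first exact: enum_val_bij.
apply/matrixP => i j; rewrite !mxE.
pose p := (enum_val i : 'I_3, enum_val j : 'I_3).
pose T (q : 'I_3 * 'I_3) := 'I_(M q.1 q.2).
have <- : #|T p| = M (enum_val i) (enum_val j) by rewrite card_ord.
have Tagged_inj : injective (fun x : T p => Tagged T x).
  by move=> x y /eqP; rewrite eq_Tagged => /eqP.
rewrite -cardsT -(card_imset _ Tagged_inj); apply: eq_card => -[[k l] x].
rewrite inE /=; apply/andP/imsetP => [[/eqP kE /eqP lE]|[y _ /(congr1 tag) [-> ->]]] //.
by subst k l; exists x.
Qed.

Lemma numbered_traces (E F : digraph) (a b : seq (seq nat)) :
  numbered E (mx3_of_rows a) -> numbered F (mx3_of_rows b) ->
  shift_equiv (adjmx E) (adjmx F) -> traces a = traces b.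
Proof.
move=> [f f_bij Ea] [g g_bij Fb] EF; rewrite !traces_mx3_of_rows.
apply/eq_in_map => k; rewrite !inE => k123.
have k_gt0 : (0 < k)%N by case/or3P: k123 => /eqP ->.
have := shift_equiv_mxtrace EF k_gt0.
by rewrite Ea Fb !mxsub_exp // !mxtrace_mxsub.
Qed.

Lemma small_graph_numbered (G : digraph) : small_graph G ->
  exists2 a, a \in small_reps & numbered G (mx3_of_rows a).
Proof.
move=> smallG; have card3 := small_card smallG.
(* Any admissible numbering will do: the transversal contains it or one of its renumberings. *)
suff [a a_adm G_a] : exists2 a, a \in [seq a <- binary_rows | admissible a]
                              & numbered G (mx3_of_rows a).
  have [a_rep|[s s_perm as_rep]] := mem_transversal a_adm.
    by exists a; [exact: a_rep|].
  by exists (renumber a s); [exact: as_rep|exact: numbered_renumber].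
pose f := cast_ord card3; pose f' := cast_ord (esym card3).
have f_bij : bijective f by exists f'; [exact: cast_ordK|exact: cast_ordKV].
pose M := mxsub f' f' (adjmx G).
have GM : adjmx G = mxsub f f M.
  by apply/matrixP => i j; rewrite !mxE /f /f' !cast_ordK.
exists (rows_of M); last by exists f; rewrite // rows_ofK.
rewrite mem_filter mem_binary_rows ?andbT; last first.
  by move=> i j; rewrite mxE adjmx_le1 //; exact: small_simple smallG.
pose pos v : 'I_3 := f (enum_rank v).
have M_pos v w : entry (rows_of M) (pos v) (pos w)
                 = adjmx G (enum_rank v) (enum_rank w).
  by rewrite entry_rows_of GM [RHS]mxE.
have edgeP v w : reflect (exists e : edge G, src e = v /\ tgt e = w)
    (entry (rows_of M) (pos v) (pos w) != 0%N).
  by rewrite M_pos -lt0n; exact: adjmx_gt0P.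
have all_pos (P : nat -> bool) : reflect (forall v, P (pos v)) (all P (iota 0 3)).
  apply: (iffP allP) => [Pall v|Pall i]; first by apply: Pall; rewrite mem_iota ltn_ord.
  rewrite mem_iota /= => lti3; have := Pall (enum_val (f' (Ordinal lti3))).
  by rewrite /pos enum_valK /f /f' cast_ordKV.
have has_pos (P : nat -> bool) : (exists v, P (pos v)) -> has P (iota 0 3).
  by case=> v Pv; apply/hasP; exists (nat_of_ord (pos v)); rewrite // mem_iota ltn_ord.
have no_sink v : exists e : edge G, src e = v.
  have [e /eqP|no_e] := pickP (fun e : edge G => src e == v); first by exists e.
  by case: (small_no_sink smallG (v := v)) => e /eqP; rewrite no_e.
apply/andP; split.
  apply/all_pos => v; apply: has_pos; have [e e_src] := no_sink v.
  by exists (tgt e); apply/edgeP; exists e.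
apply/allP => m m_mask; apply/implyP => /andP[her sat].
(* Reading the mask as a vertex subset through [pos] makes [small_hersat] applicable to it. *)
pose H := [set v | nth false m (pos v)].
have H_her : hereditary H.
  move=> e; rewrite !inE => src_m.
  move/all_pos/(_ (src e))/all_pos/(_ (tgt e)): her; rewrite src_m /=.
  by move/implyP; apply; apply/edgeP; exists e.
have H_sat : saturated H.
  move=> v _ v_out; rewrite inE.
  move/all_pos/(_ v)/implyP: sat; apply.
  apply/all_pos => w; apply/implyP => /edgeP[e [e_src <-]].
  by have := v_out e e_src; rewrite inE.
have m_const (b : bool) : (forall v, nth false m (pos v) = b) -> m = nseq 3 b.
  move=> m_b; have m_size : size m = 3%N.
    by move: m_mask; rewrite mem_choices all2E => /andP[/eqP].
  apply: (@eq_from_nth _ false); rewrite ?size_nseq // => i.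
  rewrite m_size => lti3; have := m_b (enum_val (f' (Ordinal lti3))).
  by rewrite /pos enum_valK /f /f' cast_ordKV nth_nseq lti3.
have [H0|HT] := small_hersat smallG H_her H_sat.
  rewrite (m_const false) // => v; apply/negbTE.
  by have := in_set0 v; rewrite -H0 inE => ->.
by rewrite (m_const true) // => v; have := in_setT v; rewrite -HT inE.
Qed.

Theorem mainTheorem3 :
  (forall E F : digraph, small_graph E -> small_graph F ->
     shift_equiv (adjmx E) (adjmx F) ->
     ~ ((digraph_iso E E2_3 /\ digraph_iso F E2_4) \/
        (digraph_iso E E2_4 /\ digraph_iso F E2_3)) ->
     elementary_shift_equiv (adjmx E) (adjmx F))
  /\ shift_equiv (adjmx E2_3) (adjmx E2_4)
  /\ ~ elementary_shift_equiv (adjmx E2_3) (adjmx E2_4).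
Proof.
have [f f_bij adj23] := numbered_digraph_of_mx (mx3_of_rows rows23).
have [g g_bij adj24] := numbered_digraph_of_mx (mx3_of_rows rows24).
split; last first.
  rewrite adj23 adj24; split.
    apply: shift_equiv_mxsub => //; exists 2%N.
    (* With [A] and [B] the two matrices, this [R] is unimodular and [A R = R B], so they are
       conjugate over the integers. The next witness is [R^-1 A^2]; the lag is 2 because [R^-1 A]
       has a negative entry. *)
    exists (mx3_of_rows [:: [:: 1; 0; 0]; [:: 1; 1; 0]; [:: 1; 1; 1]]%N).
    exists (mx3_of_rows [:: [:: 1; 0; 1]; [:: 0; 2; 0]; [:: 1; 0; 1]]%N).
    have sq a : mx3_of_rows a ^+ 2 = mx3_of_rows (rows_mul a a).
      by rewrite mx3_of_rowsM expr2.
    by split=> //; split; rewrite ?sq -!mx3_of_rowsM.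
  (* Undoing both numberings carries an equivalence of the adjacency matrices back to the explicit
     rows. *)
  have [f' f'_bij E23] := mxsub_bij_inv (mx3_of_rows rows23) f_bij.
  have [g' g'_bij E24] := mxsub_bij_inv (mx3_of_rows rows24) g_bij.
  move/(elementary_shift_equiv_mxsub f'_bij g'_bij); rewrite -E23 -E24.
  exact: rows23_24_not_elementary.
move=> E F smallE smallF EF not_exc.
have [a a_rep E_a] := small_graph_numbered smallE.
have [b b_rep F_b] := small_graph_numbered smallF.
have iso G c d : small_graph G -> numbered G (mx3_of_rows c) ->
    renumbers c d -> digraph_iso G (digraph_of_mx (mx3_of_rows d)).
  move=> /small_simple simpleG G_c /hasP[s s_perm /eqP <-].
  exact/numbered_iso/numbered_renumber.
have a_size := size_small_reps a_rep.
have ab := small_repsP a_rep b_rep (numbered_traces E_a F_b EF).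
(* [done] would evaluate [small_reps] on these hypotheses. *)
clear a_rep b_rep.
have ese : elementary_shift_equiv (mx3_of_rows a) (mx3_of_rows b).
  case: ab => [->|ab_ese|/andP[a23 b24]|/andP[a24 b23]].
  - exact: elementary_shift_equiv_refl.
  - exact: binary_ese_equiv a_size ab_ese.
  - by case: not_exc; left; split; [apply: iso E_a a23|apply: iso F_b b24].
  - by case: not_exc; right; split; [apply: iso E_a a24|apply: iso F_b b23].
have [f' f'_bij ->] := E_a; have [g' g'_bij ->] := F_b.
exact: elementary_shift_equiv_mxsub.
Qed.
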